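(* There exist an assignment $\Gamma\mapsto(\nu_{\Gamma},\chi_{\Gamma})$, associating to every full-rank lattice $\Gamma\subset\mathbb{C}$ a real number $\nu_{\Gamma}>0$ and a pseudo-character $\chi_{\Gamma}$ on $\Gamma$ (relative to $\nu_{\Gamma}$), such that for every full-rank lattice $\Gamma\subset\mathbb{C}$, every nonzero complex number $\lambda$, and all nonnegative integers $m,n,p,q$, $$a^{p,q}_{m,n}(\lambda\Gamma|\nu_{\lambda\Gamma},\chi_{\lambda\Gamma})=\frac{\lambda^{p}\,\overline{\lambda}^{q}}{\overline{\lambda}^{m}\lambda^{n}}\;a^{p,q}_{m,n}(\Gamma|\nu_{\Gamma},\chi_{\Gamma}).$$
   Context: Pseudo-character on a lattice $\Gamma$ relative to $\nu>0$: a map $\chi:\Gamma\to\{|\zeta|=1\}\subset\mathbb{C}$ with $\chi(\gamma+\gamma')=\chi(\gamma)\chi(\gamma')e^{\frac{\nu}{2}(\gamma\overline{\gamma'}-\overline{\gamma}\gamma')}$ for all $\gamma,\gamma'\in\Gamma$. Generalized complex Hermite-Taylor coefficients: $$a^{p,q}_{m,n}(\Gamma|\nu,\chi)=\sum_{\gamma\in\Gamma}\chi(\gamma)\gamma^p\overline{\gamma}^q e^{-\frac{\nu}{2}|\gamma|^2}H^{\nu}_{m,n}(\gamma;\overline{\gamma}),$$ where $H^{\nu}_{m,n}(z,\overline{z})=(-1)^{m+n}e^{\nu|z|^2}\dfrac{\partial^{m+n}}{\partial\overline{z}^m\partial z^n}\big(e^{-\nu|z|^2}\big)$ (Wirtinger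 derivatives). Here $\lambda\Gamma=\{\lambda\gamma:\gamma\in\Gamma\}$. *)

(* Defs.v *)
From HB Require Import structures.
From mathcomp Require Import all_boot all_order all_algebra.
From mathcomp Require Import complex.
From mathcomp Require Import all_classical all_reals all_analysis.
From mathcomp Require summability.

Set Implicit Arguments.
Unset Strict Implicit.
Unset Printing Implicit Defensive.

Import Order.TTheory GRing.Theory Num.Theory.
Import numFieldNormedType.Exports.

Local Open Scope classical_set_scope.
Local Open Scope ring_scope.
Local Open Scope complex_scope.

Section Definitions.
Variable R : realType.
Local Notation C := (R[i]).
Implicit Types (z w lambda : C) (nu : R) (Gamma : set C) (chi : C -> C).

Definition cexp z : C :=
  (expR (complex.Re z))%:C * (cos (complex.Im z) +i* sin (complex.Im z)).

(* Real partial derivatives, computed componentwise; the MathComp-Analysis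
   derivative of a map C -> C would be the holomorphic one. *)
Definition dx (f : C -> C) : C -> C := fun z =>
  (derive1 (fun t : R => complex.Re (f (z + (t +i* 0)))) 0) +i*
  (derive1 (fun t : R => complex.Im (f (z + (t +i* 0)))) 0).

Definition dy (f : C -> C) : C -> C := fun z =>
  (derive1 (fun t : R => complex.Re (f (z + (0 +i* t)))) 0) +i*
  (derive1 (fun t : R => complex.Im (f (z + (0 +i* t)))) 0).

Definition dz (f : C -> C) : C -> C := fun z =>
  (dx f z - (0 +i* 1) * dy f z) / 2%:R.

Definition dzbar (f : C -> C) : C -> C := fun z =>
  (dx f z + (0 +i* 1) * dy f z) / 2%:R.

Definition hermite nu (m n : nat) : C -> C := fun z =>
  (-1) ^+ (m + n) * cexp (nu%:C * `|z| ^+ 2) *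
  iter m dzbar (iter n dz (fun w => cexp (- nu%:C * `|w| ^+ 2))) z.

Definition full_rank_lattice Gamma : Prop :=
  exists w1 w2 : C,
    (forall s t : R, s%:C * w1 + t%:C * w2 = 0 -> s = 0 /\ t = 0) /\
    Gamma = [set z | exists k l : int, z = k%:~R * w1 + l%:~R * w2].

(* A map Gamma -> C is represented by a total map C -> C of which only the
   values on Gamma matter. *)
Definition pseudo_character Gamma nu chi : Prop :=
  (forall g, Gamma g -> `|chi g| = 1) /\
  (forall g g', Gamma g -> Gamma g' ->
     chi (g + g') =
       chi g * chi g' * cexp ((nu / 2)%:C * (g * conjc g' - conjc g * g'))).

(* Unordered sum: the limit of the partial sums over the finite subsets of
   Gamma, directed by inclusion; R[i]^o carries the topology of the modulus. *)
Definition csum Gamma (f : C -> C) : C :=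
  summability.sum (fun g : Gamma => f (val g) : C^o).

Definition hermite_taylor_coef (p q m n : nat) Gamma nu chi : C :=
  csum Gamma (fun g =>
    chi g * g ^+ p * conjc g ^+ q * cexp (- (nu / 2)%:C * `|g| ^+ 2) *
    hermite nu m n g).

Definition scale_lattice lambda Gamma : set C := [set lambda * g | g in Gamma].

End Definitions.

(* Main.v *)
(* Take chi = 1 and nu_Gamma = 2 pi / S, where S is the covolume of Gamma: for
   g, g' in Gamma the imaginary part of g g'^* is an integer multiple of S, so
   the cocycle exp(i nu Im(g g'^* )) is identically 1. The covolume is
   characterised, without reference to a basis, as the positive generator of
   { Im(g g'^* ) | g, g' in Gamma }; hence it is multiplied by |lambda|^2 when
   Gamma is replaced by lambda Gamma. Since w |-> exp(-nu |w|^2) then takes the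
   same value at z for Gamma as at lambda z for lambda Gamma, the chain rule for
   Wirtinger derivatives gives the scaling of the Hermite functions, and the
   series for lambda Gamma is, term by term, a constant multiple of the one
   for Gamma. *)
Require Import Defs.
From mathcomp Require Import all_boot all_order all_algebra.
From mathcomp Require Import complex.
From mathcomp Require Import all_classical all_reals all_analysis.
From mathcomp Require summability.
From mathcomp Require Import finmap ring lra.

Set Implicit Arguments.
Unset Strict Implicit.
Unset Printing Implicit Defensive.

Import Order.TTheory GRing.Theory Num.Theory.
Import numFieldNormedType.Exports.
Local Open Scope classical_set_scope.
Local Open Scope ring_scope.
Local Open Scope complex_scope.

(** * Calculus of Wirtinger derivatives *)

Section Wirtinger.
Variable R : realType.
Implicit Types (f g : R[i] -> R[i]) (z mu a b : R[i]).

(* The real differential of [f] at [z] is [mu |-> a mu + b mu^*], so that [a]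
   and [b] are the two Wirtinger derivatives. *)
Definition has_wirtinger f z a b := forall mu,
  is_derive (0 : R) (1 : R) (fun t => complex.Re (f (z + t%:C * mu)))
    (complex.Re (a * mu + b * conjc mu)) /\
  is_derive (0 : R) (1 : R) (fun t => complex.Im (f (z + t%:C * mu)))
    (complex.Im (a * mu + b * conjc mu)).

(** The partial derivatives are the values of the real differential in the directions [1] (here) and
    ['i] (next lemma); solving for [a] and [b] then gives [dz] and [dzbar]. *)
Lemma has_wirtinger_dx f z a b : has_wirtinger f z a b -> dx f z = a + b.
Proof.
move=> /(_ 1)[dr di]; rewrite /dx !derive1E.
have e t : t +i* 0 = t%:C * 1 :> R[i] by rewrite mulr1.
under eq_fun do rewrite e; rewrite (derive_val (is_derive := dr)).
under eq_fun do rewrite e; rewrite (derive_val (is_derive := di)).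
by rewrite conjc1 !mulr1; case: (a + b).
Qed.

Lemma has_wirtinger_dy f z a b : has_wirtinger f z a b -> dy f z = 'i * (a - b).
Proof.
move=> /(_ 'i)[dr di]; rewrite /dy !derive1E.
have e t : 0 +i* t = t%:C * 'i :> R[i].
  by apply/eqP; rewrite eq_complex /= !mul0r mulr0 mulr1 subr0 addr0 !eqxx.
under eq_fun do rewrite e; rewrite (derive_val (is_derive := dr)).
under eq_fun do rewrite e; rewrite (derive_val (is_derive := di)).
have -> : 'i * (a - b) = a * 'i + b * conjc 'i.
  have -> : conjc 'i = - 'i :> R[i].
    by apply/eqP; rewrite eq_complex /= oppr0 !eqxx.
  ring.
by case: (_ + _).
Qed.

Lemma has_wirtinger_dz f z a b : has_wirtinger f z a b -> dz f z = a.
Proof.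
move=> w; rewrite /dz (has_wirtinger_dx w) (has_wirtinger_dy w) mulrA -expr2.
by rewrite sqr_i mulN1r; field.
Qed.

Lemma has_wirtinger_dzbar f z a b : has_wirtinger f z a b -> dzbar f z = b.
Proof.
move=> w; rewrite /dzbar (has_wirtinger_dx w) (has_wirtinger_dy w) mulrA -expr2.
by rewrite sqr_i mulN1r; field.
Qed.

Lemma has_wirtinger_cst c z : has_wirtinger (fun=> c) z 0 0.
Proof.
by move=> mu; rewrite !mul0r addr0; split; exact: is_derive_cst.
Qed.

Lemma is_derive_affine (x y : R) :
  is_derive (0 : R) (1 : R) (fun t => x + t * y) y.
Proof.
apply: is_derive_eq (_ : _ = y).
by rewrite add0r mul1r scaler0 add0r [_ *: _]mulr1.
Qed.

Lemma has_wirtinger_id z : has_wirtinger id z 1 0.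
Proof.
move=> mu; rewrite mul1r mul0r addr0; case: z mu => [x y] [u v]; split => /=.
  under eq_fun do rewrite mul0r subr0; exact: is_derive_affine.
under eq_fun do rewrite mul0r addr0; exact: is_derive_affine.
Qed.

Lemma has_wirtinger_conjc z : has_wirtinger conjc z 0 1.
Proof.
move=> mu; rewrite mul1r mul0r add0r; case: z mu => [x y] [u v]; split => /=.
  under eq_fun do rewrite mul0r subr0; exact: is_derive_affine.
under eq_fun do rewrite mul0r addr0 opprD -mulrN; exact: is_derive_affine.
Qed.

Lemma ReD z1 z2 : complex.Re (z1 + z2) = complex.Re z1 + complex.Re z2.
Proof. by case: z1 z2 => [? ?] []. Qed.

Lemma ImD z1 z2 : complex.Im (z1 + z2) = complex.Im z1 + complex.Im z2.
Proof. by case: z1 z2 => [? ?] []. Qed.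

Lemma ReM z1 z2 : complex.Re (z1 * z2) =
  complex.Re z1 * complex.Re z2 - complex.Im z1 * complex.Im z2.
Proof. by case: z1 z2 => [? ?] []. Qed.

Lemma ImM z1 z2 : complex.Im (z1 * z2) =
  complex.Re z1 * complex.Im z2 + complex.Im z1 * complex.Re z2.
Proof. by case: z1 z2 => [? ?] []. Qed.

Lemma has_wirtingerD f g z a b a' b' : has_wirtinger f z a b ->
  has_wirtinger g z a' b' ->
  has_wirtinger (fun w => f w + g w) z (a + a') (b + b').
Proof.
move=> wf wg mu; have [fr fi] := wf mu; have [gr gi] := wg mu.
rewrite !mulrDl addrACA ReD ImD; split.
  under eq_fun do rewrite ReD; exact: is_deriveD.
under eq_fun do rewrite ImD; exact: is_deriveD.
Qed.

Lemma has_wirtingerM f g z a b a' b' : has_wirtinger f z a b ->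
  has_wirtinger g z a' b' ->
  has_wirtinger (fun w => f w * g w) z (a * g z + f z * a')
    (b * g z + f z * b').
Proof.
move=> wf wg mu; have [fr fi] := wf mu; have [gr gi] := wg mu.
have -> : (a * g z + f z * a') * mu + (b * g z + f z * b') * conjc mu =
    f z * (a' * mu + b' * conjc mu) + g z * (a * mu + b * conjc mu) by ring.
rewrite ReD ImD !ReM !ImM; split.
  under eq_fun do rewrite ReM.
  apply: (is_derive_eq (is_deriveB (is_deriveM fr gr) (is_deriveM fi gi))).
  rewrite !mul0r !addr0 /GRing.scale /=; ring.
under eq_fun do rewrite ImM.
apply: (is_derive_eq (is_deriveD (is_deriveM fr gi) (is_deriveM fi gr))).
rewrite !mul0r !addr0 /GRing.scale /=; ring.
Qed.

(** Moving [z] along [mu] moves [lambda * z] along [lambda * mu], and conjugation is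
    multiplicative. *)
Lemma has_wirtinger_scale f z a b lambda :
  has_wirtinger f (lambda * z) a b ->
  has_wirtinger (fun w => f (lambda * w)) z (a * lambda) (b * conjc lambda).
Proof.
move=> wf mu; have [fr fi] := wf (lambda * mu).
rewrite -!mulrA -rmorphM.
by split; under eq_fun do rewrite mulrDr mulrCA.
Qed.

(** * The Gaussian and its iterated derivatives *)

Definition gauss (nu : R) : R[i] -> R[i] :=
  fun w => cexp (- nu%:C * `|w| ^+ 2).

Lemma cexp_real (x : R) : cexp x%:C = (expR x)%:C.
Proof. by rewrite /cexp /= sin0 cos0 mulr1. Qed.

Lemma gaussE nu w :
  gauss nu w = (expR (- nu * (complex.Re w ^+ 2 + complex.Im w ^+ 2)))%:C.
Proof.
by rewrite /gauss -add_Re2_Im2 -rmorphN -rmorphM cexp_real.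
Qed.

Lemma has_wirtinger_gauss nu z :
  has_wirtinger (gauss nu) z (- nu%:C * conjc z * gauss nu z)
    (- nu%:C * z * gauss nu z).
Proof.
move=> mu; rewrite gaussE; case: z mu => [x y] [u v]; split; last first.
  (* The Gaussian is real-valued; correspondingly the two terms of its differential are conjugate to
     each other, so their sum has imaginary part 0. *)
  have -> : (fun t : R => complex.Im (gauss nu (x +i* y + t%:C * (u +i* v)))) =
      cst 0 by apply/funext => t; rewrite gaussE.
  by apply: is_derive_eq => /=; ring.
have -> : (fun t : R => complex.Re (gauss nu (x +i* y + t%:C * (u +i* v)))) =
    expR \o (fun t => - nu * ((x + t * u) ^+ 2 + (y + t * v) ^+ 2)).
  by apply/funext => t; rewrite gaussE /= !mul0r subr0 addr0.
have dx := is_derive_affine x u; have dy := is_derive_affine y v.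
have d : is_derive (0 : R) (1 : R)
    (fun t => - nu * ((x + t * u) ^+ 2 + (y + t * v) ^+ 2))
    (- nu * (2 * x * u + 2 * y * v)).
  apply: (is_derive_eq
    (is_deriveZ (- nu) (is_deriveD (is_deriveX 2 dx) (is_deriveX 2 dy)))).
  by rewrite /GRing.scale /= !mul0r !addr0 !expr1.
apply: (is_derive_eq (is_derive1_comp (is_derive_expR _) d)).
by rewrite /= !mul0r !addr0; ring.
Qed.

(* The chain rule needs real differentiability of every iterated derivative of
   the Gaussian; this class provides it, being closed under [dz] and [dzbar]. *)
Inductive gauss_poly nu : (R[i] -> R[i]) -> Prop :=
| gauss_poly_cst c : gauss_poly nu (fun=> c)
| gauss_poly_id : gauss_poly nu id
| gauss_poly_conjc : gauss_poly nu conjc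
| gauss_poly_gauss : gauss_poly nu (gauss nu)
| gauss_polyD f g : gauss_poly nu f -> gauss_poly nu g ->
    gauss_poly nu (fun w => f w + g w)
| gauss_polyM f g : gauss_poly nu f -> gauss_poly nu g ->
    gauss_poly nu (fun w => f w * g w).

(** Induction on the generators, by the sum and product rules. That [a] and [b] stay in the class is
    what allows differentiating again. *)
Lemma gauss_poly_wirtinger nu f : gauss_poly nu f ->
  exists a b : R[i] -> R[i], [/\ gauss_poly nu a, gauss_poly nu b &
    forall z, has_wirtinger f z (a z) (b z)].
Proof.
elim => {f} [c||||f g pf [a [b [pa pb w]]] pg [a' [b' [pa' pb' w']]]
                 |f g pf [a [b [pa pb w]]] pg [a' [b' [pa' pb' w']]]].
- exists (fun=> 0), (fun=> 0); split; try exact: gauss_poly_cst.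
  exact: has_wirtinger_cst.
- exists (fun=> 1), (fun=> 0); split; try exact: gauss_poly_cst.
  exact: has_wirtinger_id.
- exists (fun=> 0), (fun=> 1); split; try exact: gauss_poly_cst.
  exact: has_wirtinger_conjc.
- exists (fun z => - nu%:C * conjc z * gauss nu z),
    (fun z => - nu%:C * z * gauss nu z).
  split; last exact: has_wirtinger_gauss.
    apply: (@gauss_polyM _ (fun z => - nu%:C * conjc z));
      last exact: gauss_poly_gauss.
    apply: (@gauss_polyM _ (fun=> - nu%:C)); first exact: gauss_poly_cst.
    exact: gauss_poly_conjc.
  apply: (@gauss_polyM _ (fun z => - nu%:C * z)); last exact: gauss_poly_gauss.
  apply: (@gauss_polyM _ (fun=> - nu%:C)); first exact: gauss_poly_cst.
  exact: gauss_poly_id.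
- exists (fun z => a z + a' z), (fun z => b z + b' z).
  by split=> [||z]; [exact: gauss_polyD..|exact: has_wirtingerD].
- exists (fun z => a z * g z + f z * a' z), (fun z => b z * g z + f z * b' z).
  split=> [||z]; last exact: has_wirtingerM.
    by apply: gauss_polyD; apply: gauss_polyM.
  by apply: gauss_polyD; apply: gauss_polyM.
Qed.

(** [dz] and [dzbar] only see two directions; differentiability within the class makes them control
    all directions, as [has_wirtinger_scale] requires. *)
Lemma gauss_poly_has_wirtinger nu f z : gauss_poly nu f ->
  has_wirtinger f z (dz f z) (dzbar f z).
Proof.
move=> /gauss_poly_wirtinger[a [b [_ _ /(_ z) w]]].
by rewrite (has_wirtinger_dz w) (has_wirtinger_dzbar w).
Qed.

Lemma gauss_poly_dz nu f : gauss_poly nu f -> gauss_poly nu (dz f).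
Proof.
move=> /gauss_poly_wirtinger[a [b [pa _ w]]].
by suff -> : dz f = a by []; apply/funext => z; exact: has_wirtinger_dz.
Qed.

Lemma gauss_poly_dzbar nu f : gauss_poly nu f -> gauss_poly nu (dzbar f).
Proof.
move=> /gauss_poly_wirtinger[a [b [_ pb w]]].
by suff -> : dzbar f = b by []; apply/funext => z; exact: has_wirtinger_dzbar.
Qed.

Lemma gauss_poly_iter_dz nu n f :
  gauss_poly nu f -> gauss_poly nu (iter n (@dz R) f).
Proof. by move=> pf; elim: n => //= n; exact: gauss_poly_dz. Qed.

Lemma gauss_poly_iter_dzbar nu n f :
  gauss_poly nu f -> gauss_poly nu (iter n (@dzbar R) f).
Proof. by move=> pf; elim: n => //= n; exact: gauss_poly_dzbar. Qed.

(** * Scaling of iterated derivatives and of Hermite functions *)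

Lemma has_wirtingerZ f z a b c : has_wirtinger f z a b ->
  has_wirtinger (fun w => c * f w) z (c * a) (c * b).
Proof.
by move=> /(has_wirtingerM (has_wirtinger_cst c z)); rewrite !mul0r !add0r.
Qed.

(** The constant [c] gives both sides the same shape, so that the induction closes and the [dzbar]
    analogue applies directly to the result. *)
Lemma iter_dz_scale nu f c lambda n : gauss_poly nu f ->
  iter n (@dz R) (fun w => c * f (lambda * w)) =
  (fun w => c * lambda ^+ n * iter n (@dz R) f (lambda * w)).
Proof.
move=> pf; elim: n => [|n IHn]; first by rewrite expr0 mulr1.
rewrite iterS IHn; apply/funext => z.
have := gauss_poly_has_wirtinger (lambda * z) (gauss_poly_iter_dz n pf).
move=> /has_wirtinger_scale/(has_wirtingerZ (c * lambda ^+ n))/has_wirtinger_dz.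
by move=> ->; rewrite exprSr [_ * lambda]mulrC !mulrA.
Qed.

Lemma iter_dzbar_scale nu f c lambda n : gauss_poly nu f ->
  iter n (@dzbar R) (fun w => c * f (lambda * w)) =
  (fun w => c * conjc lambda ^+ n * iter n (@dzbar R) f (lambda * w)).
Proof.
move=> pf; elim: n => [|n IHn]; first by rewrite expr0 mulr1.
rewrite iterS IHn; apply/funext => z.
have := gauss_poly_has_wirtinger (lambda * z) (gauss_poly_iter_dzbar n pf).
move=> /has_wirtinger_scale/(has_wirtingerZ (c * conjc lambda ^+ n)).
move=> /has_wirtinger_dzbar ->.
by rewrite exprSr [_ * conjc lambda]mulrC !mulrA.
Qed.

(** The squared modulus with values in [R], where [nu] lives; the norm of [R[i]] takes its values in
    [R[i]]. *)
Definition sqnormc z : R := complex.Re z ^+ 2 + complex.Im z ^+ 2.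

Lemma sqnormcM z w : sqnormc (z * w) = sqnormc z * sqnormc w.
Proof. by rewrite /sqnormc ReM ImM; ring. Qed.

Lemma sqnormc_gt0 z : z != 0 -> 0 < sqnormc z.
Proof.
move=> z0; rewrite /sqnormc -ltcR add_Re2_Im2.
by rewrite exprn_gt0// normr_gt0.
Qed.

Lemma gauss_scale nu nu' lambda z : nu = nu' * sqnormc lambda ->
  gauss nu' (lambda * z) = gauss nu z.
Proof.
by move=> ->; rewrite !gaussE -!/(sqnormc _) sqnormcM !mulNr mulrA.
Qed.

Lemma hermite_scale nu nu' lambda m n z : nu = nu' * sqnormc lambda ->
  hermite nu m n z =
    conjc lambda ^+ m * lambda ^+ n * hermite nu' m n (lambda * z).
Proof.
move=> nuE; rewrite /hermite.
(* The factor [1] puts the Gaussian in the form expected by [iter_dz_scale], with [c = 1]. *)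
have -> : (fun w => cexp (- nu%:C * `|w| ^+ 2)) =
    (fun w => 1 * gauss nu' (lambda * w)).
  by apply/funext => w; rewrite mul1r (gauss_scale _ nuE).
have pg := gauss_poly_gauss nu'.
rewrite (iter_dz_scale _ _ _ pg) mul1r.
rewrite (iter_dzbar_scale _ _ _ (gauss_poly_iter_dz n pg)).
have -> : cexp (nu%:C * `|z| ^+ 2) = cexp (nu'%:C * `|lambda * z| ^+ 2).
  rewrite -!add_Re2_Im2 -!rmorphM -!/(sqnormc _) sqnormcM nuE.
  by rewrite mulrA.
by rewrite /gauss; ring.
Qed.

End Wirtinger.

(** * Unordered sums: change of index and constant factors *)

Section Summation.
Local Open Scope fset_scope.

Lemma nbhs_partial_sum_reindex (I J : choiceType) (K : numDomainType)
    (V : normedModType K) (x : J -> V) (h : I -> J) (h' : J -> I) :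
  cancel h h' -> cancel h' h ->
  (summability.partial_sum x @ summability.totally `<=`
   summability.partial_sum (x \o h) @ summability.totally)%classic.
Proof.
(* If [B] contains the preimage of [A] under [h], then the image of [B] contains [A] and gives the
   same partial sum. *)
move=> hK h'K P [A _ AP]; exists [fset h' j | j in A] => // B /= AB.
suff <- : summability.partial_sum x [fset h i | i in B] =
          summability.partial_sum (x \o h) B.
  apply: AP; apply/fsubsetP => j jA; apply/imfsetP; exists (h' j) => //=.
  by apply: (fsubsetP AB); apply/imfsetP; exists j.
rewrite /summability.partial_sum -!(big_seq_fsetE _ _ predT) /=.
by rewrite big_imfset//= => i j _ _; exact: (can_inj hK).
Qed.

(** The bijection used both ways shows that the two filters of partial sums are equal, hence so are
    their limits, whether or not they converge. *)
Lemma sum_reindex (I J : choiceType) (K : numDomainType)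
    (V : normedModType K) (x : J -> V) (h : I -> J) (h' : J -> I) :
  cancel h h' -> cancel h' h ->
  summability.sum (x \o h) = summability.sum x.
Proof.
move=> hK h'K; rewrite /summability.sum; congr lim; apply/seteqP; split.
  have := nbhs_partial_sum_reindex (x := x \o h) h'K hK.
  suff -> : (x \o h) \o h' = x by [].
  by apply/funext => j /=; rewrite h'K.
exact: nbhs_partial_sum_reindex hK h'K.
Qed.

(* Holds without summability, since the junk value of a divergent limit is
   [point = 0]. *)
Lemma sumZ (I : choiceType) (R : realType) (x : I -> (R[i])^o) (c : R[i]) :
  c != 0 ->
  summability.sum (fun i => c * x i : (R[i])^o) = c * summability.sum x.
Proof.
move=> c0; rewrite /summability.sum.
have F := @summability.totally_filter I.
have -> : summability.partial_sum (fun i => c * x i : (R[i])^o) =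
    c \*: summability.partial_sum x.
  by apply/funext => A; rewrite /summability.partial_sum /= scaler_sumr.
have [cx|ncx] :=
  pselect (cvg (summability.partial_sum x @ summability.totally)).
  exact: limZr.
rewrite (dvgP ncx) dvgP; first by rewrite [RHS]mulr0.
by rewrite is_cvgZlE.
Qed.

End Summation.

(** * Sums over a scaled lattice *)

Section Lattice.
Variable R : realType.
Implicit Types (Gamma : set R[i]) (lambda : R[i]) (f : R[i] -> R[i]).

Lemma csum_scale Gamma lambda c f f' : lambda != 0 -> c != 0 ->
  (forall g, f' (lambda * g) = c * f g) ->
  csum (scale_lattice lambda Gamma) f' = c * csum Gamma f.
Proof.
move=> l0 c0 ff'; rewrite /csum -sumZ//.
have hP (g : Gamma) : lambda * val g \in scale_lattice lambda Gamma.
  by apply/mem_set; exists (val g) => //; exact: set_valP.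
have hP' (g : scale_lattice lambda Gamma) : lambda^-1 * val g \in Gamma.
  apply/mem_set; have [g' Gg' <-] := set_valP g.
  by rewrite mulrA mulVf// mul1r.
(* Multiplication by [lambda] as a bijection between the index types of the two sums. *)
pose h (g : Gamma) : scale_lattice lambda Gamma := SigSub (hP g).
pose h' (g : scale_lattice lambda Gamma) : Gamma := SigSub (hP' g).
rewrite -(@sum_reindex _ _ _ _ _ h h').
- by apply: congr1; apply/funext => g /=; rewrite ff'.
- by move=> g; apply/val_inj; rewrite /= mulrA mulVf// mul1r.
- by move=> g; apply/val_inj; rewrite /= mulrA mulfV// mul1r.
Qed.

(** * The covolume of a lattice *)

Definition is_covolume Gamma (s : R) := 0 < s /\
  [set complex.Im (g * conjc g') | g in Gamma & g' in Gamma] =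
  [set k%:~R * s | k in [set: int]].

Definition covolume Gamma : R := get (is_covolume Gamma).

(** Each of [s] and [t] is a positive integer multiple of the other, hence at least as large. This
    pins down the value chosen by [get]. *)
Lemma is_covolume_uniq Gamma s t :
  is_covolume Gamma s -> is_covolume Gamma t -> s = t.
Proof.
move=> [s0 sE] [t0 tE].
have eqst :
    [set k%:~R * s | k in [set: int]] = [set k%:~R * t | k in [set: int]].
  by rewrite -sE -tE.
have ge1 (k : int) (a b : R) : 0 < a -> 0 < b -> k%:~R * a = b -> a <= b.
  move=> a0 b0 kab; rewrite -kab ler_peMl ?(ltW a0)// ler1z -gtz0_ge1 -(ltr0z R).
  by rewrite -(pmulr_lgt0 _ a0) kab.
have [k _ kE] : [set k%:~R * s | k in [set: int]] t.
  by rewrite eqst; exists 1; rewrite ?mul1r.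
have [l _ lE] : [set k%:~R * t | k in [set: int]] s.
  by rewrite -eqst; exists 1; rewrite ?mul1r.
by apply/eqP; rewrite eq_le (ge1 k)// (ge1 l).
Qed.

Lemma is_covolume_scale Gamma lambda s : lambda != 0 -> is_covolume Gamma s ->
  is_covolume (scale_lattice lambda Gamma) (sqnormc lambda * s).
Proof.
move=> l0 [s0 sE]; split; first by rewrite mulr_gt0 ?sqnormc_gt0.
have ImE g g' : complex.Im (lambda * g * conjc (lambda * g')) =
    sqnormc lambda * complex.Im (g * conjc g').
  by case: lambda g g' {l0} => [a b] [c d] [e f]; rewrite /sqnormc /=; ring.
apply/seteqP; split => [_ [_ [g Gg <-]] [_ [g' Gg' <-]] <-|_ [k _ <-]].
  rewrite ImE.
  have [k _ <-] : [set k%:~R * s | k in [set: int]] (complex.Im (g * conjc g')).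
    by rewrite -sE; exists g => //; exists g'.
  by exists k => //; rewrite mulrCA.
have [g Gg [g' Gg' gg']] :
    [set complex.Im (g * conjc g') | g in Gamma & g' in Gamma] (k%:~R * s).
  by rewrite sE; exists k.
exists (lambda * g); first by exists g.
exists (lambda * g'); first by exists g'.
by rewrite ImE gg' mulrCA.
Qed.

Lemma full_rank_lattice_covolume Gamma :
  full_rank_lattice Gamma -> is_covolume Gamma (covolume Gamma).
Proof.
move=> [w1 [w2 [free ->]]]; apply: getPex.
pose D := complex.Im (w1 * conjc w2).
have D0 : D != 0.
  (* If the determinant [D] vanishes, [d * w1 - b * w2] and [c * w1 - a * w2] are 0; independence
     kills all coordinates, and then [w1 + w2 = 0] is absurd. *)
  apply/negP => /eqP; rewrite /D {D}.
  case: w1 w2 free => [a b] [c d] free /= DE.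
  have e (s t : R) : s%:C * (a +i* b) + t%:C * (c +i* d) =
      (s * a + t * c) +i* (s * b + t * d).
    by apply/eqP; rewrite eq_complex /= !mul0r !subr0 !addr0 !eqxx.
  have {DE} DE : a * d = b * c.
    apply/esym/eqP; rewrite -subr_eq0 -[X in _ == X]DE; apply/eqP; ring.
  have [d0 b0] : d = 0 /\ - b = 0.
    apply: free; rewrite e; congr (_ +i* _); [by rewrite [d * a]mulrC DE; ring|ring].
  have [c0 a0] : c = 0 /\ - a = 0.
    apply: free; rewrite e; congr (_ +i* _); [ring|by rewrite mulNr DE; ring].
  have [] := free 1 1; last by move=> /eqP; rewrite oner_eq0.
  by rewrite e; congr (_ +i* _); lra.
have ImE (k l k' l' : int) :
    complex.Im ((k%:~R * w1 + l%:~R * w2) * conjc (k'%:~R * w1 + l'%:~R * w2)) =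
    (k * l' - l * k')%:~R * D.
  have zE (j : int) : j%:~R = (j%:~R)%:C :> R[i] by rewrite rmorph_int.
  rewrite !zE /D !intrD !intrN !intrM.
  by case: w1 w2 {free D D0} => [a b] [c d] /=; ring.
exists `|D|; split; first by rewrite normr_gt0.
(* [e] is the sign of [D], kept as an integer so that it can be absorbed into lattice
   coefficients. *)
have [e ee De] : exists2 e : int, e * e = 1 & D = e%:~R * `|D|.
  have [D_ge0|D_lt0] := lerP 0 D.
    by exists 1; rewrite ?mul1r // ger0_norm.
  by exists (-1); rewrite ?mulrNN ?mul1r // ltr0_norm // mulrN1z mulN1r opprK.
apply/seteqP; split.
  move=> _ [_ [k [l ->]]] [_ [k' [l' ->]]] <-.
  exists ((k * l' - l * k') * e) => //.
  by rewrite ImE intrM -mulrA -De.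
move=> _ [k _ <-].
(* Pairing [k e w1] with [w2] gives [k e D], which is [k] times the absolute value of [D] because
   [e * e = 1]. *)
exists ((k * e)%:~R * w1 + 0%:~R * w2); first by exists (k * e), 0.
exists (0%:~R * w1 + 1%:~R * w2); first by exists 0, 1.
rewrite ImE mul0r subr0 mulr1 {1}De mulrA -intrM -mulrA ee mulr1.
by [].
Qed.

Lemma covolume_gt0 Gamma : full_rank_lattice Gamma -> 0 < covolume Gamma.
Proof. by move=> /full_rank_lattice_covolume[]. Qed.

Lemma covolume_scale Gamma lambda : lambda != 0 -> full_rank_lattice Gamma ->
  covolume (scale_lattice lambda Gamma) = sqnormc lambda * covolume Gamma.
Proof.
move=> l0 /full_rank_lattice_covolume/(is_covolume_scale l0) sG.
apply: (is_covolume_uniq _ sG); apply: getPex.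
by exists (sqnormc lambda * covolume Gamma).
Qed.

(** * The trivial pseudo-character and the scaling of the coefficients *)

Lemma cexp_2pii_int (k : int) : cexp (0 +i* (k%:~R * (2 * pi))) = 1 :> R[i].
Proof.
have nat_case (n : nat) : cos (n%:R * (2 * pi)) = 1 :> R /\
    sin (n%:R * (2 * pi)) = 0 :> R.
  have -> : n%:R * (2 * pi) = 0 + (pi *+ 2) *+ n :> R.
    by rewrite add0r !mulr_natl.
  by rewrite (periodicn (@cosD2pi R)) (periodicn (@sinD2pi R)) cos0 sin0.
rewrite /cexp /= expR0 mul1r.
case: k => n.
  by have [-> ->] := nat_case n.
(* [Negz n] stands for [-(n + 1)], whence [n.+1] below. *)
rewrite NegzE mulrNz mulNr cosN sinN.
by have [-> ->] := nat_case n.+1; rewrite oppr0.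
Qed.

Lemma pseudo_character_one Gamma : full_rank_lattice Gamma ->
  pseudo_character Gamma (2 * pi / covolume Gamma) (fun=> 1).
Proof.
move=> G; split => [g _|g g' Gg Gg']; first exact: normr1.
have [s0 sE] := full_rank_lattice_covolume G.
have [k _ kE] : [set k%:~R * covolume Gamma | k in [set: int]]
    (complex.Im (g * conjc g')).
  by rewrite -sE; exists g => //; exists g'.
rewrite !mul1r.
(* The half in the cocycle cancels the 2 of [2 i Im (g conj g')], and the covolume cancels against
   [k * covolume Gamma], leaving [2 pi i k]. *)
suff -> : (2 * pi / covolume Gamma / 2)%:C * (g * conjc g' - conjc g * g') =
    0 +i* (k%:~R * (2 * pi)) by rewrite cexp_2pii_int.
have -> : g * conjc g' - conjc g * g' = 0 +i* (2 * complex.Im (g * conjc g')).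
  by case: g g' {Gg Gg' kE} => [a b] [c d] /=; congr (_ +i* _); ring.
rewrite -kE; apply/eqP; rewrite eq_complex /= !mul0r mulr0 subr0 eqxx addr0 /=.
apply/eqP; field; exact: lt0r_neq0.
Qed.

Lemma hermite_taylor_coef_scale (p q m n : nat) Gamma nu nu' chi chi' lambda :
  lambda != 0 -> nu = nu' * sqnormc lambda ->
  (forall g, chi' (lambda * g) = chi g) ->
  hermite_taylor_coef p q m n (scale_lattice lambda Gamma) nu' chi' =
  lambda ^+ p * conjc lambda ^+ q / (conjc lambda ^+ m * lambda ^+ n) *
    hermite_taylor_coef p q m n Gamma nu chi.
Proof.
move=> l0 nuE chiE.
have l'0 : conjc lambda != 0 by rewrite conjc_eq0.
apply: csum_scale => // [|g].
  by rewrite !mulf_neq0 ?invr_neq0 ?mulf_neq0 ?expf_neq0.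
(* The weight is itself a Gaussian, of parameter [nu / 2], so it is invariant as well. The powers of
   [g] give the numerator of the constant, and [hermite_scale], read from right to left, its
   denominator. *)
have nuE2 : nu / 2 = nu' / 2 * sqnormc lambda by rewrite nuE mulrAC.
rewrite -!/(gauss _ _) (gauss_scale g nuE2) chiE (hermite_scale m n g nuE).
rewrite rmorphM !exprMn.
field.
by rewrite !expf_neq0.
Qed.

End Lattice.

Theorem theorem2p6 (R : realType) :
  exists (nu : set R[i] -> R) (chi : set R[i] -> R[i] -> R[i]),
    (forall Gamma : set R[i], full_rank_lattice Gamma ->
       0 < nu Gamma /\ pseudo_character Gamma (nu Gamma) (chi Gamma)) /\
    (forall (Gamma : set R[i]) (lambda : R[i]) (m n p q : nat),
       full_rank_lattice Gamma -> lambda != 0 ->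
       hermite_taylor_coef p q m n (scale_lattice lambda Gamma)
         (nu (scale_lattice lambda Gamma)) (chi (scale_lattice lambda Gamma)) =
       lambda ^+ p * conjc lambda ^+ q / (conjc lambda ^+ m * lambda ^+ n) *
         hermite_taylor_coef p q m n Gamma (nu Gamma) (chi Gamma)).
Proof.
exists (fun Gamma => 2 * pi / covolume Gamma), (fun _ _ => 1); split.
  move=> Gamma G; split; last exact: pseudo_character_one.
  by rewrite divr_gt0 ?covolume_gt0 ?mulr_gt0 ?pi_gt0.
move=> Gamma lambda m n p q G l0; apply: hermite_taylor_coef_scale => //.
(* It remains to see that [2 pi / S] equals [2 pi / (s S)] times [s], with [S] the covolume and
   [s = sqnormc lambda], both nonzero. *)
have := lt0r_neq0 (sqnormc_gt0 l0); have := lt0r_neq0 (covolume_gt0 G).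
by move=> ? ?; rewrite covolume_scale//; field; apply/andP.
Qed.
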